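(* Let $H$ be a nonnegative weighted graph of even order $n\ge 4$ with weighted adjacency matrix $B_H$, let $s=\sum_{u<v}(B_H)_{uv}$, $t=\sum_{u<v}(B_H)_{uv}^2$, $N=n+1$, and let $M>s$ be real. Let $W_M(H)$ be the weighted cone over $H$ with cone weight $M$, and set $$T=\frac{4Mn^2-4s}{N},\qquad Q=\sqrt{2nM^2+2t}.$$ Then $$\Phi(W_M(H))\ge T\quad\text{and}\quad \operatorname{FR}_{\min}(W_M(H))\ge\frac{T}{Q}.$$ Equality holds (in the first bound, equivalently in the second) if and only if $H$ has a fixed-point-free involutory automorphism preserving its weights.
   Context: A nonnegative weighted graph is a pair $(V,w)$ with $V$ a finite set and $w:\binom{V}{2}\to[0,\infty)$; its weighted adjacency matrix $W=(w_{uv})$ is symmetric with zero diagonal. Its order is $|V|$. For a weighted adjacency matrix $W$ of order $N$, a labeling is a bijection $\pi:\mathbb{Z}_N\to V$, and $W_\pi$ is the matrix indexed by $\mathbb{Z}_N$ with entries $W_\pi(x,y)=w_{\pi(x)\pi(y)}$. Let $F_N(r,x)=\frac{1}{\sqrt N}e^{-2\pi i rx/N}$ for $r,x\in\mathbb{Z}_N$. For a matrix $C$, $\|C\|_1=\sum_{r,v}|C_{rv}|$ and $\|C\|_2=(\sum_{r,v}|C_{rv}|^2)^{1/2}$. Define $\Phi(W)=\min_\pi\|F_NW_\pi F_N\|_1$, the minimum over all labelings, and, for $W\neq 0$, $\operatorname{FR}_{\min}(W)=\Phi(W)/\|W\|_2$ (which equals $\min_\pi \|F_NW_\pi F_N\|_1/\|F_NW_\pi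 F_N\|_2$). The weighted cone $W_M(H)$ is the weighted graph of order $N=n+1$ obtained from $H$ by adjoining one new vertex $c$ and giving every edge from $c$ to a vertex of $H$ weight $M$ (weights inside $H$ are unchanged); the same symbol denotes its weighted adjacency matrix. An automorphism of a weighted graph is a permutation of its vertices preserving all weights, including zero weights. A permutation $\tau$ is an involution if $\tau^2=\mathrm{id}$, and is fixed-point-free if $\tau(v)\ne v$ for every vertex $v$. *)

(* Defs.v *)
From HB Require Import structures.
From mathcomp Require Import all_boot all_order all_algebra all_fingroup.
From mathcomp Require Import all_classical all_reals all_analysis.
From mathcomp Require Import complex.

Set Implicit Arguments.
Unset Strict Implicit.
Unset Printing Implicit Defensive.

Import Order.TTheory GRing.Theory Num.Theory.
Local Open Scope ring_scope.
Local Open Scope complex_scope.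

Section WeightedGraphs.
Variables (R : realType) (V : finType).
Implicit Type w : V -> V -> R.

(* A weighting of the unordered pairs of V is given by its weighted adjacency
   matrix (w u v), symmetric with zero diagonal. *)
Record weighted_graph w : Prop := WeightedGraph {
  weight_sym : forall u v, w u v = w v u;
  weight_diag : forall v, w v v = 0;
  weight_ge0 : forall u v, 0 <= w u v }.

(* The sum over "u < v" of f u v, each unordered pair being counted once; the
   order on V is that of its canonical enumeration, which is immaterial when f
   is symmetric (sum_pairs_double). *)
Definition sum_pairs (f : V -> V -> R) : R :=
  \sum_u \sum_(v | (enum_rank u < enum_rank v)%N) f u v.

Definition automorphism w (sigma : {perm V}) : Prop :=
  forall u v, w (sigma u) (sigma v) = w u v.

Definition fixed_point_free (sigma : {perm V}) : Prop :=
  forall v, sigma v != v.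

(* The cone; its apex is None. *)
Definition cone (M : R) w : option V -> option V -> R := fun a b =>
  match a, b with
  | Some u, Some v => w u v
  | None, None => 0
  | _, _ => M
  end.

End WeightedGraphs.

Section Norms.
Variables (R : realType) (I J : finType).

(* ComplexField.Normc.normc : R[i] -> R is the modulus. *)
Definition norm1 (C : I -> J -> R[i]) : R :=
  \sum_i \sum_j ComplexField.Normc.normc (C i j).

Definition norm2 (C : I -> J -> R[i]) : R :=
  Num.sqrt (\sum_i \sum_j ComplexField.Normc.normc (C i j) ^+ 2).

End Norms.

Section Fourier.
Variable R : realType.

Definition expi (theta : R) : R[i] := cos theta +i* sin theta.

(* Z_N is represented by the residues 0, ..., N - 1. *)
Definition fourier (N : nat) : 'M[R[i]]_N := \matrix_(r, x)
  ((Num.sqrt N%:R)^-1%:C * expi (- (2 * pi * r%:R * x%:R / N%:R))).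

Variable V : finType.
Implicit Types (W : V -> V -> R) (p : {ffun 'I_#|V| -> V}).

(* As #|'I_#|V| | = #|V|, injective means bijective here (labelingP). *)
Definition labeling p : bool := injectiveb p.

Definition relabel W p : 'M[R[i]]_#|V| := \matrix_(x, y) (W (p x) (p y))%:C.

Definition fourier_norm W p : R :=
  norm1 (fourier #|V| *m relabel W p *m fourier #|V|).

(* The minimum over all labelings: the default value of the iterated minimum
   is the value at a particular labeling (Phi_le, Phi_attained). *)
Definition Phi W : R :=
  \big[Order.min/fourier_norm W [ffun x => enum_val x]]_(p | labeling p)
    fourier_norm W p.

Definition FRmin W : R := Phi W / norm2 (fun u v => (W u v)%:C).

End Fourier.

Section Facts.
Variables (R : realType) (V : finType).
Implicit Types (w W : V -> V -> R) (p : {ffun 'I_#|V| -> V}).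

Lemma weighted_graph_cone (M : R) w :
  0 <= M -> weighted_graph w -> weighted_graph (cone M w).
Proof.
move=> M0 [ws wd wp]; split.
- by move=> [u|] [v|] //=.
- by move=> [u|] //=.
- by move=> [u|] [v|] //=.
Qed.

Lemma sum_pairs_double w :
  weighted_graph w -> \sum_u \sum_v w u v = sum_pairs w *+ 2.
Proof.
move=> [ws wd _]; rewrite mulr2n /sum_pairs.
rewrite [X in _ + X](exchange_big_dep xpredT) //= -big_split /=.
apply: eq_bigr => u _; rewrite (bigID (fun v => (enum_rank u < enum_rank v)%N)) /=.
congr (_ + _); rewrite [LHS](bigD1 u) ?ltnn //= wd add0r.
apply: eq_big => [v|v _]; last exact: ws.
by rewrite -leqNgt [RHS]ltn_neqAle andbC (inj_eq val_inj) (inj_eq enum_rank_inj).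
Qed.

Lemma labelingP p : reflect (bijective p) (labeling p).
Proof.
rewrite /labeling; apply: (iffP (injectiveP _)) => [pI|/bij_inj //].
by apply: inj_card_bij => //; rewrite card_ord.
Qed.

Lemma labeling_enum : labeling [ffun x : 'I_#|V| => enum_val x].
Proof. by apply/injectiveP => x y; rewrite !ffunE; apply: enum_val_inj. Qed.

Lemma Phi_le W p : labeling p -> Phi W <= fourier_norm W p.
Proof. by move=> pl; apply: bigmin_le_cond. Qed.

Lemma Phi_attained W : exists2 p, labeling p & Phi W = fourier_norm W p.
Proof.
rewrite /Phi; elim/big_ind: _ => [|x y [p pl ->] [q ql ->]|p pl].
- by exists [ffun x => enum_val x] => //; exact: labeling_enum.
- by case: leP => _; [exists p | exists q].
- by exists p.
Qed.

End Facts.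

(* Main.v *)
(* Put the apex at the residue 0 (a translation of the labeling only multiplies
   the Fourier coefficients by phases) and let D(r, v) be the unnormalised
   coefficients of the relabelled matrix A.  For the cone with H removed,
   D(r, v) = M (N [r = 0] + N [v = 0] - 2), whose sign is -1 exactly when r and
   v are both nonzero.  The sum of the real parts Re D(r, v) weighted by these
   signs is linear in A and, by orthogonality of characters, equals
   4 M n^2 - 4 s whatever the labeling; this bounds the 1-norm from below.
   Since H perturbs each D(r, v) by at most 2 s < 2 M, the signs of the real
   parts are never upset, so equality means that every D(r, v) is real, i.e.
   (Fourier inversion) that A is invariant under x |-> - x.  As N is odd, this
   map fixes only 0 and induces the required involution of H; conversely an
   involution without fixed points can be written as x |-> - x by a suitable
   labeling. *)

Require Import Defs.
From mathcomp Require Import all_boot all_order all_algebra all_fingroup.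
From mathcomp Require Import all_classical all_reals all_analysis.
From mathcomp Require Import complex.
From mathcomp Require Import ring lra.

Set Implicit Arguments.
Unset Strict Implicit.
Unset Printing Implicit Defensive.

Import Order.TTheory GRing.Theory Num.Theory.
Local Open Scope ring_scope.

Local Open Scope complex_scope.
Local Notation normc := ComplexField.Normc.normc.
Local Notation Re := (@complex.Re _).
Local Notation Im := (@complex.Im _).

(** * Complex exponentials *)

Section Expi.
Variable R : realType.
Implicit Types (a b : R) (z : R[i]).

Lemma expi0 : expi (0 : R) = 1.
Proof. by rewrite /expi cos0 sin0. Qed.

Lemma expiD a b : expi (a + b) = expi a * expi b.
Proof.
by apply/eqP; rewrite eq_complex /= cosD sinD eqxx [sin a * _ + _]addrC eqxx.
Qed.

Lemma expiX a k : expi a ^+ k = expi (a * k%:R).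
Proof.
elim: k => [|k IH]; first by rewrite mulr0 expi0.
by rewrite exprS IH -expiD -[k.+1]addn1 natrD mulrDr mulr1 addrC.
Qed.

Lemma expi_conjM a : (expi a)^* * expi a = 1.
Proof.
apply/eqP; rewrite eq_complex /= mulNr opprK -!expr2 cos2Dsin2 eqxx /=.
by rewrite mulNr mulrC subrr.
Qed.

(** The real part is 1 - 2 sin^2(pi k / N), and the sine is positive strictly between 0 and pi. *)
Lemma expi_neq1 (k N : nat) : (0 < k < N)%N ->
  expi (- (2 * pi / N%:R * k%:R) : R) != 1.
Proof.
move=> /andP[k0 kN]; have N0 := leq_ltn_trans (leq0n k) kN.
have s0 : 0 < sin (pi * (k%:R / N%:R) : R).
  rewrite sin_gt0_pi // mulr_gt0 ?pi_gt0 ?divr_gt0 ?ltr0n //=.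
  by rewrite gtr_pMr ?pi_gt0 // ltr_pdivrMr ?ltr0n // mul1r ltr_nat.
apply/eqP => /(congr1 (@complex.Re R)) /=; rewrite cosN.
have -> : 2 * pi / N%:R * k%:R = (pi * (k%:R / N%:R)) *+ 2 :> R.
  by rewrite -mulr_natr; ring.
rewrite cos_mulr2n cos2sin2 => h.
have : sin (pi * (k%:R / N%:R) : R) ^+ 2 = 0.
  by move: h; rewrite -mulr_natr; lra.
by apply/eqP; rewrite expf_eq0 /= gt_eqF.
Qed.

Lemma Re_sum I (r : seq I) (F : I -> R[i]) :
  Re (\sum_(i <- r) F i) = \sum_(i <- r) Re (F i).
Proof.
by elim: r => [|i r IH]; rewrite ?big_nil ?big_cons //= -IH;
   case: (F i) (\sum_(_ <- _) _) => ? ? [].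
Qed.

Lemma Re_realM a z : Re (a%:C * z) = a * Re z.
Proof. by case: z => x y /=; rewrite mul0r subr0. Qed.

Lemma normc_sum I (r : seq I) (F : I -> R[i]) :
  normc (\sum_(i <- r) F i) <= \sum_(i <- r) normc (F i).
Proof.
elim/big_rec2: _ => [|i y x _ le]; first by rewrite ComplexField.Normc.normc0.
by rewrite (le_trans (le_normcD _ _)) // lerD2l.
Qed.

Lemma ler_Re_normc z : `|Re z| <= normc z.
Proof.
by case: z => x y /=; rewrite -sqrtr_sqr ler_wsqrtr // lerDl sqr_ge0.
Qed.

Lemma normc_Re z : Im z = 0 -> normc z = `|Re z|.
Proof. by case: z => x y /= ->; rewrite expr0n addr0 sqrtr_sqr. Qed.

Lemma normc_eqRe_Im z : normc z <= `|Re z| -> Im z = 0.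
Proof.
case: z => x y /=; rewrite -sqrtr_sqr ler_sqrt ?addr_ge0 ?sqr_ge0 // => h.
by apply/eqP; rewrite -sqrf_eq0 eq_le sqr_ge0 andbT; lra.
Qed.

Lemma normc_real a : normc a%:C = `|a|.
Proof. by rewrite normc_Re. Qed.

Lemma Im_eq0_conj z : Im z = 0 <-> z^* = z.
Proof.
case: z => x y /=; split=> [->|[]]; first by rewrite oppr0.
by lra.
Qed.

End Expi.

(** * The Fourier transform on Z_N, N = m + 1 *)

Section Characters.
Variables (R : realType) (m : nat).
Implicit Types (r v x y : 'I_m.+1) (A : 'I_m.+1 -> 'I_m.+1 -> R).

(** Written as a power of one root of unity, so that addition of residues becomes addition of
    exponents modulo [m.+1]. *)
Definition zchar r x : R[i] := expi (- (2 * pi / m.+1%:R)) ^+ (r * x).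

Lemma zcharE r x :
  zchar r x = expi (- (2 * pi * r%:R * x%:R / m.+1%:R)).
Proof. by rewrite /zchar expiX natrM; congr expi; ring. Qed.

Lemma expi_root : expi (- (2 * pi / m.+1%:R) : R) ^+ m.+1 = 1.
Proof.
rewrite expiX mulNr divfK ?pnatr_eq0 // /expi cosN sinN mulr_natl.
by rewrite cos2pi sin2pi oppr0.
Qed.

Lemma zcharDl r v x : zchar (r + v) x = zchar r x * zchar v x.
Proof.
by rewrite /zchar -exprD -mulnDl -(expr_mod _ expi_root) modnMml
   (expr_mod _ expi_root).
Qed.

Lemma zcharC r x : zchar r x = zchar x r.
Proof. by rewrite /zchar mulnC. Qed.

Lemma zcharDr r x y : zchar r (x + y) = zchar r x * zchar r y.
Proof. by rewrite !(zcharC r) zcharDl. Qed.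

Lemma zchar0l x : zchar 0 x = 1.
Proof. by rewrite /zchar mul0n expr0. Qed.

Lemma zchar0r r : zchar r 0 = 1.
Proof. by rewrite zcharC zchar0l. Qed.

Lemma zchar_conj r x : (zchar r x)^* = zchar (- r) x.
Proof.
have h : (zchar r x)^* * zchar r x = 1.
  by rewrite /zchar rmorphXn -exprMn expi_conjM expr1n.
have z0 : zchar r x != 0.
  by apply/eqP => z0; move/eqP: h; rewrite z0 mulr0 eq_sym oner_eq0.
by apply: (mulIf z0); rewrite h -zcharDl addNr zchar0l.
Qed.

Lemma zcharNC r x : zchar (- r) x = zchar r (- x).
Proof.
have z0 : zchar r x != 0.
  apply/eqP => z0; have := zcharDl (- r) r x.
  by rewrite addNr zchar0l z0 mulr0 => /eqP; rewrite oner_eq0.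
by apply: (mulIf z0); rewrite -zcharDl -zcharDr !addNr zchar0l zchar0r.
Qed.

Lemma normc_zchar r x : normc (zchar r x) = 1.
Proof. by rewrite zcharE /= cos2Dsin2 sqrtr1. Qed.

(** For nonzero [x] this is a full geometric sum whose ratio is an N-th root of unity different from
    1. *)
Lemma sum_zchar x : \sum_r zchar r x = (m.+1 * (x == 0))%:R.
Proof.
case: eqVneq => [->|x0].
  under eq_bigr do rewrite zchar0r.
  by rewrite sumr_const card_ord muln1.
rewrite muln0; apply/eqP.
rewrite (eq_bigr (fun i : 'I_m.+1 => (expi (- (2 * pi / m.+1%:R)) ^+ x) ^+ i)).
  2: by move=> i _; rewrite /zchar mulnC exprM.
have /eqP := subrX1 (expi (- (2 * pi / m.+1%:R) : R) ^+ x) m.+1.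
rewrite -exprM mulnC exprM expi_root expr1n subrr eq_sym mulf_eq0 => /orP[|//].
rewrite subr_eq0 expiX mulNr (negPf (expi_neq1 _ _)) //.
by rewrite lt0n x0 ltn_ord.
Qed.

Definition dft A r v : R[i] :=
  \sum_x \sum_y (A x y)%:C * (zchar r x * zchar v y).

(** Product weights on the frequency side move to the vertex side as a product of transforms.
    Characters as weights give inversion; the indicator of nonzero frequencies gives the signed
    sum. *)
Lemma dft_pairing A (f g : 'I_m.+1 -> R[i]) :
  \sum_r \sum_v f r * g v * dft A r v =
  \sum_x \sum_y (A x y)%:C * (\sum_r f r * zchar r x) *
    (\sum_v g v * zchar v y).
Proof.
under eq_bigr => r _ do under eq_bigr => v _ do rewrite mulr_sumr.
under eq_bigr => r _ do rewrite exchange_big.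
rewrite exchange_big; apply: eq_bigr => x _ /=.
under eq_bigr => r _ do under eq_bigr => v _ do rewrite mulr_sumr.
under eq_bigr => r _ do rewrite exchange_big.
rewrite exchange_big; apply: eq_bigr => y _ /=.
rewrite -mulrA mulr_suml mulr_sumr; apply: eq_bigr => r _.
rewrite mulr_sumr mulr_sumr; apply: eq_bigr => v _; ring.
Qed.

Lemma dft_inversion A a b :
  \sum_r \sum_v zchar r (- a) * zchar v (- b) * dft A r v =
  (m.+1%:R ^+ 2 * A a b)%:C.
Proof.
have h c x : \sum_r zchar r (- c) * zchar r x = (m.+1 * (x == c))%:R.
  under eq_bigr do rewrite -zcharDr.
  by rewrite sum_zchar addrC subr_eq0.
rewrite dft_pairing (bigD1 a) //= [X in _ + X]big1 ?addr0; last first.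
  move=> x xa; apply: big1 => y _.
  by rewrite h (negPf xa) muln0 mulr0 mul0r.
rewrite (bigD1 b) //= [X in _ + X]big1 ?addr0; last first.
  by move=> y yb; rewrite [X in _ * X]h (negPf yb) muln0 mulr0.
rewrite !h !eqxx muln1 rmorphM rmorphXn rmorph_nat; ring.
Qed.

Lemma dft_conj A r v : (dft A r v)^* = dft A (- r) (- v).
Proof.
rewrite /dft rmorph_sum; apply: eq_bigr => x _.
rewrite rmorph_sum; apply: eq_bigr => y _.
by rewrite !rmorphM /= !zchar_conj oppr0.
Qed.

(** Conjugation negates both frequencies, which amounts to reflecting [A]. By inversion the
    coefficients determine [A], so they are all real exactly when the reflection fixes [A]. *)
Lemma dft_real A :
  (forall r v, Im (dft A r v) = 0) <-> (forall x y, A (- x) (- y) = A x y).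
Proof.
have dN r v : dft A (- r) (- v) = dft (fun x y => A (- x) (- y)) r v.
  rewrite /dft [RHS](reindex_inj oppr_inj); apply: eq_bigr => x _.
  rewrite [RHS](reindex_inj oppr_inj); apply: eq_bigr => y _.
by rewrite !opprK !zcharNC.
split=> [h x y|h r v].
  have [] : (m.+1%:R ^+ 2 * A (- x) (- y))%:C = (m.+1%:R ^+ 2 * A x y)%:C.
    rewrite -[LHS](dft_inversion (fun x y => A (- x) (- y))) -dft_inversion.
    apply: eq_bigr => r _; apply: eq_bigr => v _; congr (_ * _).
    by rewrite -dN -dft_conj; apply/Im_eq0_conj.
  by apply: mulfI; rewrite expf_eq0 /= pnatr_eq0.
apply/Im_eq0_conj; rewrite dft_conj dN.
by apply: eq_bigr => x _; apply: eq_bigr => y _; rewrite h.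
Qed.

Lemma normc_dft_le A r v : normc (dft A r v) <= \sum_x \sum_y `|A x y|.
Proof.
apply: (le_trans (normc_sum _ _)); apply: ler_sum => x _.
apply: (le_trans (normc_sum _ _)); apply: ler_sum => y _.
by rewrite !ComplexField.Normc.normcM !normc_zchar !mulr1 normc_real.
Qed.

(** A translation multiplies each coefficient by a product of two characters, of modulus 1; this
    lets any vertex be moved to residue 0. *)
Lemma normc_dft_shift A z r v :
  normc (dft (fun x y => A (x + z) (y + z)) r v) = normc (dft A r v).
Proof.
have -> : dft A r v = zchar r z * zchar v z *
    dft (fun x y => A (x + z) (y + z)) r v.
  rewrite [in LHS]/dft (reindex_inj (addIr z)) mulr_sumr.
  apply: eq_bigr => x _; rewrite (reindex_inj (addIr z)) mulr_sumr.
  apply: eq_bigr => y _; rewrite !zcharDr; ring.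
by rewrite !ComplexField.Normc.normcM !normc_zchar !mul1r.
Qed.

Definition cone_sign r v : R := 1 - 2 * ((r != 0) && (v != 0))%:R.

Lemma norm_cone_sign r v : `|cone_sign r v| = 1.
Proof.
rewrite /cone_sign; case: (_ && _); rewrite ?mulr0 ?mulr1 ?subr0 ?normr1 //.
by rewrite (_ : 1 - 2 = -1) ?normrN ?normr1 //; ring.
Qed.

Lemma cone_sign_Re_le r v (z : R[i]) : cone_sign r v * Re z <= normc z.
Proof.
apply: (le_trans (ler_norm _)); rewrite normrM norm_cone_sign mul1r.
exact: ler_Re_normc.
Qed.

(** The constant part of the sign is inversion at (0, 0). The other part is a product f(r) f(v),
    where f is the indicator of nonzero residues, with transform N [x = 0] - 1. *)
Lemma sum_cone_sign_dft A :
  \sum_r \sum_v cone_sign r v * Re (dft A r v) =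
  m.+1%:R ^+ 2 * A 0 0 - 2 * \sum_x \sum_y
    A x y * ((m.+1 * (x == 0))%:R - 1) * ((m.+1 * (y == 0))%:R - 1).
Proof.
pose f r : R[i] := (r != 0)%:R.
have hf x : \sum_r f r * zchar r x = (m.+1 * (x == 0))%:R - 1.
  rewrite -sum_zchar [in RHS](bigD1 0) //= zchar0l addrC addrK.
  rewrite (bigD1 0) //= /f eqxx mul0r add0r; apply: eq_bigr => r /negPf ->.
  by rewrite mul1r.
have E := dft_pairing A f f; have E0 := dft_inversion A 0 0.
have -> : m.+1%:R ^+ 2 * A 0 0 = Re (\sum_r \sum_v dft A r v).
  transitivity (Re (m.+1%:R ^+ 2 * A 0 0)%:C) => //; rewrite -E0; congr Re.
  apply: eq_bigr => r _; apply: eq_bigr => v _.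
  by rewrite oppr0 !zchar0r !mul1r.
have -> : \sum_x \sum_y
    A x y * ((m.+1 * (x == 0))%:R - 1) * ((m.+1 * (y == 0))%:R - 1) =
    Re (\sum_r \sum_v f r * f v * dft A r v).
  rewrite E Re_sum; apply: eq_bigr => x _.
  rewrite Re_sum; apply: eq_bigr => y _.
  rewrite -!mulrA Re_realM !hf; congr (_ * _).
  set a := (_ * _)%N; set b := (_ * _)%N.
  by rewrite -[_ * _ in LHS]/(Re (_ )%:C) rmorphM !rmorphB !rmorph_nat rmorph1.
rewrite !Re_sum mulr_sumr -sumrB; apply: eq_bigr => r _.
rewrite !Re_sum mulr_sumr -sumrB; apply: eq_bigr => v _.
have -> : f r * f v = ((r != 0) && (v != 0))%:R%:C.
  by rewrite rmorph_nat /f -natrM mulnb.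
rewrite Re_realM /cone_sign; ring.
Qed.

End Characters.

Arguments zchar {R m}.

(** * The cone with its apex at 0 *)

Lemma sum_option (R : nmodType) (V : finType) (F : option V -> R) :
  \sum_a F a = F None + \sum_v F (Some v).
Proof.
rewrite (bigD1 None) //= (reindex_omap Some id) /=; last by case.
by congr (_ + _); apply: eq_bigl => v; rewrite eqxx.
Qed.

Lemma sumr_const_natr (R : pzRingType) (V : finType) (c : R) :
  \sum_(v : V) c = c * #|V|%:R.
Proof. by rewrite sumr_const mulr_natr. Qed.

Section SpectralCone.
Variables (R : realType) (V : finType) (m : nat) (H : V -> V -> R) (M : R).
Variable q : 'I_m.+1 -> option V.
Hypotheses (Hw : weighted_graph H) (qB : bijective q) (q0 : q 0 = None).

Local Notation s := (sum_pairs H).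
Local Notation A := (fun x y => cone M H (q x) (q y)).

Lemma sum_pairs_ge0 (f : V -> V -> R) :
  (forall u v, 0 <= f u v) -> 0 <= sum_pairs f.
Proof. by move=> f0; apply: sumr_ge0 => u _; apply: sumr_ge0. Qed.

Lemma card_cone_base : #|V| = m.
Proof.
have [g qK gK] := qB; apply: succn_inj.
rewrite -card_option -[RHS]card_ord; symmetry.
by apply: bij_eq_card; exists g.
Qed.

Lemma q_eq0 x : (x == 0) = (q x == None).
Proof. by rewrite -q0 (inj_eq (bij_inj qB)). Qed.

(** Each ordered pair inside [H] has factor (-1)(-1) = 1, for a total of 2 s. Each of the 2 m
    ordered pairs with the apex has factor -m and weight [M]. Multiplication by -2 gives the
    formula. *)
Lemma cone_sign_sum :
  \sum_r \sum_v cone_sign R r v * Re (dft A r v) =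
  4 * M * m%:R ^+ 2 - 4 * s.
Proof.
rewrite sum_cone_sign_dft /= q0 /= mulr0 sub0r.
pose F a b : R := cone M H a b * ((m.+1 * (a == None))%:R - 1) *
  ((m.+1 * (b == None))%:R - 1).
have -> : \sum_x \sum_y cone M H (q x) (q y) * ((m.+1 * (x == 0))%:R - 1) *
     ((m.+1 * (y == 0))%:R - 1) = \sum_a \sum_b F a b.
  rewrite [RHS](reindex q) /=; last exact: onW_bij.
  apply: eq_bigr => x _; rewrite [RHS](reindex q) /=; last exact: onW_bij.
  by apply: eq_bigr => y _; rewrite /F !q_eq0.
rewrite sum_option sum_option /F /=.
under [X in _ + X]eq_bigr do rewrite sum_option.
rewrite big_split /= !mul0r add0r !muln1 !muln0.
have -> : \sum_u \sum_v H u v * (0%:R - 1) * (0%:R - 1) = s *+ 2.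
  rewrite -(sum_pairs_double Hw); apply: eq_bigr => u _.
  by apply: eq_bigr => v _; rewrite sub0r !mulrN1 opprK.
rewrite !sumr_const_natr card_cone_base mulr2n -[m.+1]addn1 natrD.
ring.
Qed.

Lemma norm_sum_dft_ge :
  4 * M * m%:R ^+ 2 - 4 * s <= \sum_r \sum_v normc (dft A r v).
Proof.
rewrite -cone_sign_sum; apply: ler_sum => r _; apply: ler_sum => v _.
exact: cone_sign_Re_le.
Qed.

(** Splits off the star of the apex, whose coefficients are explicit; [cone 0 H] is [H] with an
    isolated vertex added. *)
Lemma dft_cone r v : Re (dft A r v) =
  M * ((m.+1 * (r == 0))%:R + (m.+1 * (v == 0))%:R - 2) +
  Re (dft (fun x y => cone 0 H (q x) (q y)) r v).
Proof.
pose d (x : 'I_m.+1) : R := (x == 0)%:R.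
(* The product term cancels the diagonal entry that [d x + d y] puts at the apex. *)
have E x y : (A x y)%:C = (cone 0 H (q x) (q y))%:C +
    M%:C * ((d x)%:C + (d y)%:C - 2 * (d x)%:C * (d y)%:C).
  rewrite /d !q_eq0; case: (q x) (q y) => [a|] [b|] /=;
  rewrite ?rmorph0 ?rmorph1; ring.
have S f : \sum_x (d x)%:C * f x = f 0 :> R[i].
  rewrite (bigD1 0) //= /d eqxx rmorph1 mul1r big1 ?addr0 // => x /negPf ->.
  by rewrite rmorph0 mul0r.
have Z (r' : 'I_m.+1) : \sum_x zchar r' x = (m.+1 * (r' == 0))%:R :> R[i].
  by under eq_bigr do rewrite zcharC; exact: sum_zchar.
have -> : dft A r v = dft (fun x y => cone 0 H (q x) (q y)) r v +
    (M * ((m.+1 * (r == 0))%:R + (m.+1 * (v == 0))%:R - 2))%:C.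
  transitivity (dft (fun x y => cone 0 H (q x) (q y)) r v +
    M%:C * ((\sum_x (d x)%:C * zchar r x) * (\sum_y zchar v y) +
            (\sum_x zchar r x) * (\sum_y (d y)%:C * zchar v y) -
            2 * ((\sum_x (d x)%:C * zchar r x) *
                 (\sum_y (d y)%:C * zchar v y)))).
    rewrite !mulr_suml !mulr_sumr -big_split /= -sumrB mulr_sumr -big_split /=.
    apply: eq_bigr => x _.
    rewrite !mulr_sumr -big_split /= -sumrB mulr_sumr -big_split /=.
    by apply: eq_bigr => y _; rewrite E; ring.
  rewrite !S !Z !zchar0r !mul1r !mulr1.
  rewrite rmorphM rmorphB (rmorphD (real_complex R)) !rmorph_nat.
  by rewrite [X in X - _]addrC.
by rewrite addrC; case: (dft _ _ _).
Qed.

Lemma norm_sum_dft_eq : s < M -> (4 <= m)%N ->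
  \sum_r \sum_v normc (dft A r v) = 4 * M * m%:R ^+ 2 - 4 * s <->
  (forall x y, A (- x) (- y) = A x y).
Proof.
move=> sM m4; have s0 : 0 <= s by apply: sum_pairs_ge0; case: Hw.
rewrite -dft_real -cone_sign_sum; split=> [E r v|E].
  have/eqP := E; rewrite eq_sym pair_bigA [X in _ == X]pair_bigA /=.
  (* The termwise bounds by the modulus add up to an equality, so each of them is an equality. *)
  rewrite eq_sym -subr_eq0 -sumrB => /eqP/psumr_eq0P E0.
  have D0 (i : 'I_m.+1 * 'I_m.+1) : true -> 0 <= normc (dft A i.1 i.2) -
      cone_sign R i.1 i.2 * Re (dft A i.1 i.2).
    by rewrite subr_ge0 cone_sign_Re_le.
  have /eqP := E0 D0 (r, v) isT.
  rewrite subr_eq0 => /eqP Erv; apply: normc_eqRe_Im.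
  by rewrite Erv /= -[leRHS]mul1r -(norm_cone_sign R r v) -normrM ler_norm.
apply: eq_bigr => r _; apply: eq_bigr => v _.
rewrite normc_Re // -[LHS]mul1r -(norm_cone_sign R r v) -normrM ger0_norm //.
(* The part coming from [H] is at most the sum of all its matrix entries, namely 2 s. *)
have B : `|Re (dft (fun x y => cone 0 H (q x) (q y)) r v)| <= s *+ 2.
  apply: (le_trans (ler_Re_normc _)); apply: (le_trans (normc_dft_le _ _ _)).
  rewrite -(sum_pairs_double Hw).
  have -> : \sum_x \sum_y `|cone 0 H (q x) (q y)| =
      \sum_a \sum_b `|cone 0 H a b|.
    rewrite [RHS](reindex q) /=; last exact: onW_bij.
    by apply: eq_bigr => x _; rewrite [RHS](reindex q) //=; exact: onW_bij.
  rewrite sum_option sum_option /=.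
  under [X in _ + X]eq_bigr do rewrite sum_option.
  rewrite big_split /= !sumr_const normr0 mul0rn !add0r.
  rewrite le_eqVlt; apply/orP; left; apply/eqP.
  apply: eq_bigr => u _; apply: eq_bigr => w _; rewrite ger0_norm //.
  by case: Hw.
move: B; rewrite ler_norml dft_cone /cone_sign mulr2n.
set e := Re _ => /andP[B1 B2].
have m4R : 4 <= m%:R :> R by rewrite ler_nat.
have MmM : 4 * M <= m%:R * M by rewrite ler_wpM2r //; lra.
(* The star contributes 2 m M, (m - 1) M or -2 M, according to whether two, one or none of [r], [v]
   vanish. Each exceeds 2 s in absolute value, so the sign survives. *)
case: (r == 0); case: (v == 0) => /=; rewrite ?muln0 ?muln1 -?(natr1 _ m); lra.
Qed.

End SpectralCone.

(** * Labelings and involutions *)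

Section Labelings.
Variables (R : realType) (U : finType) (W : U -> U -> R) (m : nat).
Hypothesis cardU : m.+1 = #|U|.

(** Indexed by a visible successor [m.+1] rather than [#|U|], so that residues can be added and
    negated. *)
Let norm_dft (q : 'I_m.+1 -> U) : R :=
  m.+1%:R^-1 * \sum_r \sum_v normc (dft (fun x y => W (q x) (q y)) r v).

Lemma fourier_norm_dft (p : {ffun 'I_#|U| -> U}) :
  fourier_norm W p = norm_dft (p \o cast_ord cardU).
Proof.
rewrite /norm_dft; move: p; rewrite /fourier_norm /relabel /=.
(* Eliminating the equation makes the cast the identity. *)
case: #|U| / cardU => p; rewrite /norm1 mulr_sumr; apply: eq_bigr => r _.
rewrite mulr_sumr; apply: eq_bigr => v _.
have N0 : 0 <= m.+1%:R^-1 :> R by rewrite invr_ge0 ler0n.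
rewrite -[X in X * _](ger0_norm N0) -normc_real -ComplexField.Normc.normcM.
congr normc.
rewrite mxE /dft [in RHS]exchange_big mulr_sumr; apply: eq_bigr => y _ /=.
rewrite mxE mulr_suml mulr_sumr; apply: eq_bigr => x _.
rewrite !mxE !cast_ord_id [zchar v y]zcharC !zcharE.
(* Each of the two Fourier matrices supplies one factor 1 / sqrt N. *)
have -> : m.+1%:R^-1%:C = (Num.sqrt m.+1%:R)^-1%:C * (Num.sqrt m.+1%:R)^-1%:C
    :> R[i].
  by rewrite -rmorphM -invfM -expr2 sqr_sqrtr ?ler0n.
ring.
Qed.

Lemma labeling_centered (c : U) p : labeling p ->
  exists q : 'I_m.+1 -> U,
    [/\ bijective q, q 0 = c & fourier_norm W p = norm_dft q].
Proof.
move=> /labelingP [g pK gK].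
(* The residue at which [p] places [c]; translating by it brings [c] to 0. *)
pose z := cast_ord (esym cardU) (g c).
exists (fun x => p (cast_ord cardU (x + z))); split.
- exists (fun a => cast_ord (esym cardU) (g a) - z) => [x|a].
    by rewrite pK cast_ordK addrK.
  by rewrite subrK cast_ordKV gK.
- by rewrite add0r cast_ordKV gK.
rewrite fourier_norm_dft /norm_dft; congr (_ * _).
apply: eq_bigr => r _; apply: eq_bigr => v _; rewrite /=.
by rewrite -[LHS](normc_dft_shift _ z).
Qed.

Lemma labeling_of (q : 'I_m.+1 -> U) : bijective q ->
  exists2 p, labeling p & fourier_norm W p = norm_dft q.
Proof.
move=> /bij_inj qI; exists [ffun x => q (cast_ord (esym cardU) x)].
  by apply/injectiveP => x y; rewrite !ffunE => /qI /cast_ord_inj.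
rewrite fourier_norm_dft /norm_dft; congr (_ * _).
apply: eq_bigr => r _; apply: eq_bigr => v _; congr normc.
by apply: eq_bigr => x _; apply: eq_bigr => y _; rewrite /= !ffunE !cast_ordK.
Qed.

End Labelings.

(** A solution satisfies 2 x = 0 modulo the odd number [m.+1], and 2 is coprime to it. *)
Lemma opp_eq_ord (m : nat) (x : 'I_m.+1) : ~~ odd m -> (- x == x) = (x == 0).
Proof.
move=> mE; apply/eqP/eqP => [h|->]; last exact: oppr0.
have : x + x = 0 by rewrite -{1}h addNr.
move=> /(congr1 val) /= /eqP; rewrite -/(dvdn _ _) addnn -mul2n Gauss_dvdr.
  by move=> /dvdn_leq h'; apply/val_inj/eqP; rewrite /= -leqn0 leqNgt;
     apply/negP => /h'; rewrite leqNgt ltn_ord.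
by rewrite coprime_sym coprime2n /= mE.
Qed.

Section Involutions.
Variables (R : realType) (V : finType) (m : nat) (H : V -> V -> R) (M : R).
Hypotheses (mE : ~~ odd m) (cardV : #|V| = m).

Lemma involution_of_labeling (q : 'I_m.+1 -> option V) :
    bijective q -> q 0 = None ->
    (forall x y, cone M H (q (- x)) (q (- y)) = cone M H (q x) (q y)) ->
  exists tau : {perm V},
    [/\ automorphism H tau, involutive tau & fixed_point_free tau].
Proof.
move=> [g qK gK] q0 sym.
(* Negation of residues read through [q]. The default is never taken: only residue 0 is sent to 0,
   and it carries the apex. *)
pose f v := odflt v (q (- g (Some v))).
have fE v : Some (f v) = q (- g (Some v)).
  rewrite /f; case E: (q _) => [//|]; exfalso.
  move: E; rewrite -q0 => /(can_inj qK)/eqP; rewrite oppr_eq0 => /eqP E.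
  by have := gK (Some v); rewrite E q0.
have fK : involutive f.
  by move=> v; apply: Some_inj; rewrite !fE qK opprK gK.
exists (perm (can_inj fK)); split=> [u v|v|v]; rewrite !permE ?fK //.
  by have := sym (g (Some u)) (g (Some v)); rewrite -!fE !gK.
(* A fixed vertex would sit at a residue equal to its negative, hence at 0, where the apex is. *)
apply/eqP => fv; have := fE v; rewrite fv => E.
have := congr1 g E; rewrite qK => /esym/eqP; rewrite opp_eq_ord // => /eqP E0.
by have := gK (Some v); rewrite E0 q0.
Qed.

Lemma labeling_of_involution (tau : {perm V}) :
    automorphism H tau -> involutive tau -> fixed_point_free tau ->
  exists q : 'I_m.+1 -> option V, [/\ bijective q, q 0 = None &
    forall x y, cone M H (q (- x)) (q (- y)) = cone M H (q x) (q y)].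
Proof.
move=> aut tauK fpf.
(* One representative of each two-element orbit of [tau], the one of smaller rank. *)
pose S := enum [set v | (enum_rank v < enum_rank (tau v))%N].
(* A palindrome up to [tau]: position [m - 1 - i] holds the [tau]-image of
   position [i]. *)
pose L := S ++ rev (map tau S).
have SE v : (v \in S) = (enum_rank v < enum_rank (tau v))%N.
  by rewrite mem_enum inE.
have SN v : (v \in map tau S) = ~~ (v \in S).
  rewrite -[v in LHS]tauK (mem_map (can_inj tauK)) !SE tauK -leqNgt.
  by rewrite ltn_neqAle (inj_eq val_inj) (inj_eq enum_rank_inj) (negPf (fpf v)).
have Lmem v : v \in L by rewrite mem_cat mem_rev SN orbN.
have Luniq : uniq L.
  rewrite cat_uniq rev_uniq (map_inj_uniq (can_inj tauK)) enum_uniq !andbT.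
  by apply/hasPn => v; rewrite mem_rev SN.
have Lsize : size L = m.
  by rewrite -cardV -(card_uniqP Luniq); apply: eq_card => v; rewrite Lmem.
have Lrev : rev L = map tau L.
  by rewrite rev_cat revK map_cat map_rev -map_comp (eq_map tauK) map_id.
pose q (x : 'I_m.+1) := nth None (None :: map Some L) x.
have qU : uniq (None :: map Some L).
  rewrite /= (map_inj_uniq Some_inj) Luniq andbT.
  by apply/negP => /mapP[].
have qsz : size (None :: map Some L) = m.+1 by rewrite /= size_map Lsize.
have qI : injective q.
  move=> x y /eqP; rewrite nth_uniq ?qsz ?ltn_ord // => /eqP; exact: val_inj.
have qN x : q (- x) = omap tau (q x).
  case: (eqVneq x 0) => [->|x0]; first by rewrite oppr0.
  have x0' : (0 < x)%N by rewrite lt0n.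
  rewrite /q /= modn_small; last by rewrite ltn_subrL x0'.
  (* With the apex in front, residue i + 1 holds entry i of [L]. Its negative m - i holds entry m -
     i - 1, which is entry i of [rev L]. *)
  case: (nat_of_ord x) x0' (ltn_ord x) => [//|i] _ im.
  rewrite subSS; have -> : (m - i = (m - i.+1).+1)%N by rewrite subnSK.
  (* A default vertex for [nth]; there is one because a nonzero residue forces [m] to be
     positive. *)
  have [v0 _] : exists v0 : V, True.
    by case: (L) Lsize => [/= m0|v0 _ _]; [move: im; rewrite -m0 | exists v0].
  rewrite /= !(nth_map v0) ?Lsize ?ltn_subrL //=; last by case: (m) im.
  rewrite -[X in (X - _)%N]Lsize -nth_rev ?Lsize // Lrev (nth_map v0) ?Lsize //.
exists q; split=> [|//|x y].
  by apply: inj_card_bij qI _; rewrite card_option card_ord cardV.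
by rewrite !qN; case: (q x) (q y) => [u|] [v|] //=; apply: aut.
Qed.

End Involutions.

(** * The Euclidean norm of the cone and the final bounds *)

Lemma norm2_cone (R : realType) (V : finType) (H : V -> V -> R) (M : R) :
  weighted_graph H ->
  norm2 (fun u v => (cone M H u v)%:C) =
  Num.sqrt (2 * #|V|%:R * M ^+ 2 + 2 * sum_pairs (fun u v => H u v ^+ 2)).
Proof.
move=> [Hs Hd H0]; congr Num.sqrt.
have W2 : weighted_graph (fun u v => H u v ^+ 2).
  by split=> [u v|v|u v]; rewrite ?(Hs u) ?Hd ?expr0n ?sqr_ge0.
under eq_bigr => a _ do under eq_bigr => b _ do
  rewrite normc_real real_normK ?num_real //.
rewrite sum_option sum_option /=.
under [X in _ + X]eq_bigr do rewrite sum_option.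
rewrite big_split /= !sumr_const_natr (sum_pairs_double W2) expr0n add0r.
rewrite mulr2n; ring.
Qed.

Theorem theorem3p2 (R : realType) (V : finType) (H : V -> V -> R)
    (n : nat) (M : R) :
  weighted_graph H -> #|V| = n -> ~~ odd n -> (4 <= n)%N ->
  let s := sum_pairs H in
  let t := sum_pairs (fun u v => H u v ^+ 2) in
  let N := n.+1 in
  s < M ->
  let W := cone M H in
  let T := (4 * M * n%:R ^+ 2 - 4 * s) / N%:R in
  let Q := Num.sqrt (2 * n%:R * M ^+ 2 + 2 * t) in
  let has_ffi_automorphism := exists tau : {perm V},
    [/\ automorphism H tau, involutive tau & fixed_point_free tau] in
  [/\ T <= Phi W,
      T / Q <= FRmin W,
      Phi W = T <-> has_ffi_automorphism
    & FRmin W = T / Q <-> has_ffi_automorphism].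
Proof.
move=> Hw cardV nE n4 s t N sM W T Q has_ffi.
have cardU : N = #|{: option V}| by rewrite card_option cardV.
have N0 : 0 < N%:R :> R by rewrite ltr0n.
have s0 : 0 <= s by apply: sum_pairs_ge0; case: Hw.
have Q0 : 0 < Q.
  rewrite sqrtr_gt0 ltr_pwDl ?mulr_ge0 //; last first.
    by apply: sum_pairs_ge0 => u v; rewrite sqr_ge0.
  by rewrite !mulr_gt0 ?exprn_gt0 ?ltr0n ?(leq_trans _ n4) ?(le_lt_trans s0).
(* [Q] is the norm of the matrix and does not depend on the labeling, so both claims on [FRmin]
   reduce to those on [Phi]. *)
have FRE : FRmin W = Phi W / Q by rewrite /FRmin norm2_cone // cardV.
have TE x : N%:R^-1 * x = T <-> x = 4 * M * n%:R ^+ 2 - 4 * s.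
  rewrite /T mulrC; split=> [|->//]; apply: mulIf.
  by rewrite invr_eq0 gt_eqF.
have lower p : labeling p -> T <= fourier_norm W p.
  move=> /(labeling_centered W cardU None)[q [qB q0 ->]].
  by rewrite /T mulrC ler_pM2l ?invr_gt0 // norm_sum_dft_ge.
have PhiT : T <= Phi W by have [p /lower le ->] := Phi_attained W.
have PhiE : Phi W = T <-> has_ffi.
  split=> [|[tau [aut tauK fpf]]].
    have [p pl ->] := Phi_attained W.
    have [q [qB q0 ->]] := labeling_centered W cardU None pl.
    move=> /TE/(norm_sum_dft_eq Hw qB q0 sM n4).
    exact: involution_of_labeling.
  have [q [qB q0 sym]] := labeling_of_involution M cardV aut tauK fpf.
  have [p pl pE] := labeling_of W cardU qB.
  (* The symmetric labeling attains [T], so the minimum is at most [T]. *)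
  apply/le_anti/andP; split=> //; apply: (le_trans (Phi_le W pl)).
  by rewrite pE le_eqVlt; apply/orP; left; apply/eqP/TE/norm_sum_dft_eq.
split=> //; first by rewrite FRE ler_pM2r ?invr_gt0.
rewrite FRE -PhiE; split=> [|-> //]; apply: mulIf.
by rewrite invr_eq0 gt_eqF.
Qed.
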